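(* Let $X$ be a real normed space with $\dim X\ge 2$. The following conditions are equivalent: (i) $X$ is smooth. (ii) There exist a normed space $Y$ and a nonvanishing linear mapping $T:X\to Y$ such that $x\perp_{\rho_*}y\Longrightarrow Tx\perp_{\rho}Ty$ for all $x,y\in X$. (iii) There exist a normed space $Y$ and a nonvanishing linear mapping $T:X\to Y$ such that $x\perp_{\rho}y\Longrightarrow Tx\perp_{\rho_*}Ty$ for all $x,y\in X$.
   Context: Normed spaces are real. The norm derivatives are $\rho_{\pm}(x,y):=\lim_{t\to 0^{\pm}}\frac{\|x+ty\|^2-\|x\|^2}{2t}$. Put $\rho(x,y):=\frac{1}{2}(\rho_-(x,y)+\rho_+(x,y))$ and $\rho_*(x,y):=\rho_-(x,y)\rho_+(x,y)$. For $\diamondsuit\in\{\rho,\rho_*\}$, $x\perp_{\diamondsuit}y$ iff $\diamondsuit(x,y)=0$. $X$ is smooth if there is a unique supporting hyperplane at each point of the unit sphere (equivalently, the norm is Gâteaux differentiable at every nonzero point). ''Nonvanishing'' means not identically zero. *)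

(* Defs.v *)
From HB Require Import structures.
From mathcomp Require Import all_boot all_order all_algebra.
From mathcomp Require Import all_classical all_reals all_analysis.

Set Implicit Arguments.
Unset Strict Implicit.
Unset Printing Implicit Defensive.

Import Order.TTheory GRing.Theory Num.Theory.
Import numFieldNormedType.Exports.

Local Open Scope classical_set_scope.
Local Open Scope ring_scope.

Section NormDerivatives.
Context {R : realType} {X : normedModType R}.
Implicit Types x y : X.

Definition rho_quotient x y (t : R) : R :=
  (`|x + t *: y| ^+ 2 - `|x| ^+ 2) / (2 * t).

(* Both one-sided limits exist for all [x] and [y], by convexity of the norm. *)
Definition rho_minus x y : R := lim (rho_quotient x y t @[t --> 0^'-]).

Definition rho_plus x y : R := lim (rho_quotient x y t @[t --> 0^'+]).

Definition rho x y : R := 2^-1 * (rho_minus x y + rho_plus x y).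

Definition rho_star x y : R := rho_minus x y * rho_plus x y.

Definition rho_orthogonal x y : Prop := rho x y = 0.

Definition rho_star_orthogonal x y : Prop := rho_star x y = 0.

End NormDerivatives.

(* [H] is a closed affine hyperplane through [x] with the closed unit ball on
   one side of it. The side is no restriction: [(f, c)] and [(- f, - c)]
   define the same [H]. *)
Definition supporting_hyperplane (R : realType) (X : normedModType R)
    (x : X) (H : set X) : Prop :=
  exists (f : {linear X -> R^o}) (c : R),
    [/\ continuous f, exists y, f y != 0, H = [set y | f y = c],
        H x & forall y, `|y| <= 1 -> f y <= c].

Definition smooth (R : realType) (X : normedModType R) : Prop :=
  forall x : X, `|x| = 1 -> exists! H : set X, supporting_hyperplane x H.

(* dim X >= 2, where X may be infinite-dimensional. *)
Definition dim_ge2 (R : realType) (X : normedModType R) : Prop :=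
  exists x y : X, forall a b : R, a *: x + b *: y = 0 -> a = 0 /\ b = 0.

Definition nonvanishing (R : realType) (X Y : normedModType R)
    (T : {linear X -> Y}) : Prop :=
  exists x : X, T x != 0.

(* Main.v *)
From HB Require Import structures.
Require Import Defs.
From mathcomp Require Import all_boot all_order all_algebra.
From mathcomp Require Import all_classical all_reals all_analysis.
From mathcomp Require Import ring lra.
Import numFieldNormedType.Exports.
Import Order.TTheory GRing.Theory Num.Theory.
Local Open Scope ring_scope.
Local Open Scope classical_set_scope.

(** Smoothness is the equality of the two norm derivatives: for a unit vector
    [x], the functionals defining supporting hyperplanes at [x] are the linear
    functionals below the sublinear functional [rho_plus x], and by the
    Hahn-Banach theorem there is only one exactly when [rho_plus x] is odd,
    that is, when [rho_minus x = rho_plus x] ([smoothP]). When the derivatives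
    agree, [rho] and [rho_star] have the same zeros and the identity of [X]
    preserves either orthogonality.

    For the converse directions, the basic device is the shift identity
    [rho_plus x (a x + y) = a |x|^2 + rho_plus x y], valid also for [rho_minus]
    and [rho]: subtracting a suitable multiple of [x] makes any [y] orthogonal
    to [x]. An orthogonality-preserving [T] thus satisfies an identity between
    norm derivatives in [X] and in [Y].

    - If [T] sends [rho_star] to [rho] orthogonality, both
      [rho_plus x y |Tx|^2] and [rho_minus x y |Tx|^2] equal
      [rho (Tx) (Ty) |x|^2] ([rho_star_to_rho]), so the two derivatives agree
      wherever [Tx] is nonzero.

    - If [T] sends [rho] to [rho_star] orthogonality, [rho x y |Tx|^2] is one of
      the two numbers [rho_minus (Tx) (Ty) |x|^2] and [rho_plus (Tx) (Ty) |x|^2]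
      ([rho_to_rho_star]). Apply this at [x + s y] and let [s] decrease to [0]:
      the one-sided derivatives of a convex function at points right of [0] all
      tend to its right derivative at [0] ([rho_plus_line_cvg]), so that
      [rho_plus x y |Tx|^2 = rho_plus (Tx) (Ty) |x|^2] ([rho_plus_similar]),
      and likewise for [rho_minus]. Hence the mean of [rho_minus x y] and
      [rho_plus x y] is one of them, and they agree.

    Both arguments need [T] to be injective. If [T z = 0] and [T x] is nonzero,
    then [rho (x + s z) z = 0] for every [s]; the convex function
    [s |-> |x + s z|^2] is then constant, which forces [z = 0]
    ([eq0_rho_line]). *)

(** * The Hahn-Banach theorem for sublinear functionals *)

Definition sublinear {R : realType} {V : lmodType R} (p : V -> R) : Prop :=
  (forall x y, p (x + y) <= p x + p y) /\
  (forall a x, 0 <= a -> p (a *: x) <= a * p x).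

Lemma sublinear0 {R : realType} {V : lmodType R} {p : V -> R} :
  sublinear p -> p 0 = 0.
Proof.
move=> [pD pZ]; apply/eqP; rewrite eq_le.
have := pZ 0 0 (lexx 0); have := pD 0 0; rewrite scale0r addr0; lra.
Qed.

Lemma sublinear_geN {R : realType} {V : lmodType R} {p : V -> R} (x : V) :
  sublinear p -> - p (- x) <= p x.
Proof.
move=> ps; have := ps.1 x (- x).
by rewrite subrr sublinear0 //; lra.
Qed.

Lemma sublinearZ {R : realType} {V : lmodType R} {p : V -> R} (a : R) (x : V) :
  sublinear p -> 0 <= a -> p (a *: x) = a * p x.
Proof.
move=> ps; rewrite le_eqVlt => /orP[/eqP<-|a0].
  by rewrite scale0r mul0r sublinear0.
apply/le_anti; rewrite (ps.2 _ _ (ltW a0))/=.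
have := ps.2 a^-1 (a *: x); rewrite invr_ge0 (ltW a0) scalerA mulVf ?gt_eqF//.
by rewrite scale1r ler_pdivlMl// => /(_ isT).
Qed.

(** Subadditivity applied to [x + y] and [- y] gives the reverse inequality. *)
Lemma odd_sublinear_linear {R : realType} {V : lmodType R} {p : V -> R} :
  sublinear p -> (forall x, p (- x) <= - p x) ->
  exists f : {linear V -> R^o}, forall x, f x = p x.
Proof.
move=> ps pN.
have pE x : p (- x) = - p x.
  by apply/le_anti; rewrite pN/=; have := sublinear_geN x ps; lra.
have pD x y : p (x + y) = p x + p y.
  apply/le_anti; rewrite ps.1/=.
  by have := ps.1 (x + y) (- y); rewrite addrK pE; lra.
have pZ a x : p (a *: x) = a * p x.
  have [a0|a0] := leP 0 a; first exact: sublinearZ.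
  have := sublinearZ (- a) x ps; rewrite oppr_ge0 (ltW a0) => /(_ isT).
  by rewrite scaleNr pE mulNr => /oppr_inj.
have p_lin : linear (p : V -> R^o) by move=> a x y; rewrite pD pZ.
pose f : {linear V -> R^o} :=
  HB.pack (p : V -> R^o) (GRing.isLinear.Build R V R^o *:%R p p_lin).
by exists f.
Qed.

(** The pointwise infimum is subadditive because of the chain condition: of two
    members [q] and [r], the smaller one bounds the infimum at [x + y] by
    [q x + r y]. *)
Lemma sublinear_chain_inf {R : realType} {V : lmodType R} (A : set (V -> R))
    (b : V -> R) :
  A !=set0 -> (forall q, A q -> sublinear q /\ (forall x, b x <= q x)) ->
  (forall q r, A q -> A r -> (forall x, q x <= r x) \/ (forall x, r x <= q x)) ->
  exists m, sublinear m /\ (forall q x, A q -> m x <= q x).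
Proof.
move=> [q0 Aq0] Aq Atot.
pose E x := [set q x | q in A]; pose m x := inf (E x).
have Elb x : has_lbound (E x).
  by exists (b x) => _ [q /Aq[_ bq] <-].
have mle q x : A q -> m x <= q x.
  by move=> qA; apply: ge_inf => //; exists q.
have lem x c : (forall q, A q -> c <= q x) -> c <= m x.
  move=> cq; apply: lb_le_inf; first by exists (q0 x), q0.
  by move=> _ [q /cq cqx <-].
exists m; split => //; split=> [x y|a x a0].
- rewrite -lerBlDr; apply: (lem) => q qA; rewrite lerBlDr -lerBlDl.
  apply: (lem) => r rA; rewrite lerBlDl.
  have [qr|rq] := Atot _ _ qA rA.
  + apply: (le_trans (mle _ _ qA)); apply: (le_trans ((Aq _ qA).1.1 _ _)).
    by rewrite lerD2l.
  + apply: (le_trans (mle _ _ rA)); apply: (le_trans ((Aq _ rA).1.1 _ _)).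
    by rewrite lerD2r.
- have [->|an0] := eqVneq a 0.
    rewrite scale0r mul0r; apply: (le_trans (mle _ _ Aq0)).
    by rewrite sublinear0//; exact: (Aq _ Aq0).1.
  have ap : 0 < a by rewrite lt_neqAle eq_sym an0.
  rewrite mulrC -ler_pdivrMr//; apply: (lem) => q qA.
  rewrite ler_pdivrMr// mulrC; apply: (le_trans (mle _ _ qA)).
  exact: (Aq _ qA).1.2.
Qed.

(** The infimal convolution of [p] with the functional [- t y |-> - t p y] on the
    ray spanned by [- y], that is [x |-> inf_(t >= 0) (p (x + t y) - t p y)], is
    again sublinear. A minimal sublinear functional is therefore odd. *)
Lemma sublinear_lower {R : realType} {V : lmodType R} {p : V -> R} (y : V) :
  sublinear p ->
  exists q, [/\ sublinear q, forall x, q x <= p x & q (- y) <= - p y].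
Proof.
move=> ps.
pose E x := [set p (x + t *: y) - t * p y | t in [set t : R | 0 <= t]].
pose q x := inf (E x).
have Elb x : has_lbound (E x).
  exists (- p (- x)) => _ [t t0 <-].
  have := ps.1 (x + t *: y) (- x).
  by rewrite addrAC subrr add0r (sublinearZ _ _ ps t0); lra.
have qle x t : 0 <= t -> q x <= p (x + t *: y) - t * p y.
  by move=> t0; apply: ge_inf => //; exists t.
have leq x c : (forall t, 0 <= t -> c <= p (x + t *: y) - t * p y) -> c <= q x.
  move=> cq; apply: lb_le_inf.
    by exists (p (x + 0 *: y) - 0 * p y), 0 => //=.
  by move=> _ [t /cq + <-].
exists q; split.
- split=> [x z|a x a0].
  + rewrite -lerBlDr; apply: (leq) => s s0; rewrite lerBlDr -lerBlDl.
    apply: (leq) => t t0; rewrite lerBlDl.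
    apply: (le_trans (qle _ (s + t) _)); first exact: addr_ge0.
    have := ps.1 (x + s *: y) (z + t *: y).
    by rewrite addrACA -scalerDl; lra.
  + have [->|an0] := eqVneq a 0.
      rewrite scale0r mul0r; apply: (le_trans (qle _ 0 (lexx _))).
      by rewrite scale0r addr0 sublinear0// mul0r subr0.
    have ap : 0 < a by rewrite lt_neqAle eq_sym an0.
    rewrite mulrC -ler_pdivrMr//; apply: (leq) => t t0.
    rewrite ler_pdivrMr// mulrC; apply: (le_trans (qle _ (a * t) _)).
      exact: mulr_ge0.
    have := ps.2 a (x + t *: y) a0; rewrite scalerDr scalerA; lra.
- move=> x; apply: (le_trans (qle _ 0 (lexx _))).
  by rewrite scale0r addr0 mul0r subr0.
- apply: (le_trans (qle _ 1 ler01)).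
  by rewrite scale1r addNr sublinear0// mul1r sub0r.
Qed.

(** Zorn's lemma; [x |-> - p (- x)] is a lower bound common to all sublinear
    functionals below [p]. *)
Lemma minimal_sublinear {R : realType} {V : lmodType R} {p : V -> R} :
  sublinear p ->
  exists q, [/\ sublinear q, forall x, q x <= p x &
    forall r, sublinear r -> (forall x, r x <= q x) -> r = q].
Proof.
move=> ps.
pose S := {q : V -> R | sublinear q /\ forall x, q x <= p x}.
pose below (q r : S) := `[< forall x, sval r x <= sval q x >].
have [| | | |[q [qs qp]] qmin] := @Zorn S below.
- by move=> q; apply/asboolP.
- move=> q r s /asboolP rq /asboolP sr; apply/asboolP => x.
  exact: le_trans (sr x) (rq x).
- move=> [q qP] [r rP] /asboolP/= rq /asboolP/= qr.
  by apply/eq_exist/funext => x; apply/le_anti; rewrite qr rq.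
- move=> A Atot.
  have [[q0 Aq0]|A0] := pselect (A !=set0); last first.
    by exists (exist _ p (conj ps (fun x => lexx _))) => q Aq; case: A0; exists q.
  have [|q [r _ <-]|_ _ [q Aq <-] [r Ar <-]|m [ms mA]] :=
    sublinear_chain_inf (sval @` A) (fun x => - p (- x)).
  + by exists (sval q0), q0.
  + case: r => /= r [rs rp]; split=> // x.
    by apply: le_trans (sublinear_geN x rs); rewrite lerN2.
  + by have [/asboolP|/asboolP] := Atot _ _ Aq Ar; [right|left].
  have mp x : m x <= p x.
    by apply: le_trans ((svalP q0).2 x); apply: mA; exists q0.
  by exists (exist _ m (conj ms mp)) => q Aq; apply/asboolP => x; apply: mA; exists q.
exists q; split=> // r rs rq.
have rp x : r x <= p x by exact: le_trans (rq x) (qp x).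
have : below (exist _ q (conj qs qp)) (exist _ r (conj rs rp)) by apply/asboolP.
by move=> /qmin[].
Qed.

(** Lowering [p] so that its value at [- y] becomes [- p y] before minimizing
    forces the value of the minimal functional at [y]. *)
Lemma hahn_banach {R : realType} {V : lmodType R} {p : V -> R} (y : V) :
  sublinear p ->
  exists f : {linear V -> R^o}, (forall x, f x <= p x) /\ f y = p y.
Proof.
move=> ps; have [p' [p's p'p p'N]] := sublinear_lower y ps.
have [q [qs qp' qmin]] := minimal_sublinear p's.
have qN x : q (- x) <= - q x.
  have [r [rs rq rN]] := sublinear_lower x qs.
  by rewrite (qmin r rs rq) in rN.
have [f fE] := odd_sublinear_linear qs qN.
exists f; split=> [x|]; first by rewrite fE; exact: le_trans (qp' x) (p'p x).
apply/le_anti; rewrite fE (le_trans (qp' y) (p'p y))/=.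
have := qp' (- y); have := sublinear_geN y qs; lra.
Qed.

(** * One-sided norm derivatives *)

(** The defect of convexity of the square is [l (1 - l) (|u| - |v|)^2]. *)
Lemma sqr_norm_convex {R : realType} {X : normedModType R} (l : R) (u v : X) :
  0 <= l -> l <= 1 ->
  `|(1 - l) *: u + l *: v| ^+ 2 <= (1 - l) * `|u| ^+ 2 + l * `|v| ^+ 2.
Proof.
move=> l0 l1.
have : `|(1 - l) *: u + l *: v| <= (1 - l) * `|u| + l * `|v|.
  by rewrite (le_trans (ler_normD _ _))// !normrZ !ger0_norm// subr_ge0.
move=> /(lerXn2r 2%N)-/(_ _ _)/le_trans; apply.
- by rewrite nnegrE.
- by rewrite nnegrE addr_ge0// mulr_ge0// subr_ge0.
rewrite -subr_ge0.
have -> : (1 - l) * `|u| ^+ 2 + l * `|v| ^+ 2 - ((1 - l) * `|u| + l * `|v|) ^+ 2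
  = l * (1 - l) * (`|u| - `|v|) ^+ 2 by ring.
by rewrite mulr_ge0 ?sqr_ge0// mulr_ge0// subr_ge0.
Qed.

(** Slopes of the convex function [t |-> |x + t y|^2] from [0] increase; the
    limit defining [rho_plus] is thus an infimum. *)
Lemma rho_quotient_mono {R : realType} {X : normedModType R} (x y : X) (s t : R) :
  0 < s -> s <= t -> rho_quotient x y s <= rho_quotient x y t.
Proof.
move=> s0 st; have t0 := lt_le_trans s0 st.
have l0 : 0 <= s / t by rewrite divr_ge0// ltW.
have l1 : s / t <= 1 by rewrite ler_pdivrMr// mul1r.
have := sqr_norm_convex (s / t) x (x + t *: y) l0 l1.
rewrite scalerDr addrA -scalerDl subrK scale1r scalerA divfK ?gt_eqF// => h.
rewrite /rho_quotient ler_pdivrMr ?mulr_gt0//.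
rewrite [leRHS](_ : _ = s / t * (`|x + t *: y| ^+ 2 - `|x| ^+ 2)); first by lra.
by field; rewrite gt_eqF.
Qed.

Lemma rho_quotient_ge {R : realType} {X : normedModType R} (x y : X) (t : R) :
  0 < t -> - (`|x| * `|y|) <= rho_quotient x y t.
Proof.
move=> t0; rewrite /rho_quotient ler_pdivlMr ?mulr_gt0//.
have : `|x| <= `|x + t *: y| + t * `|y|.
  by rewrite -{1}(addrK (t *: y) x) (le_trans (ler_normB _ _))// normrZ gtr0_norm.
have := normr_ge0 x; have := sqr_ge0 (`|x + t *: y| - `|x|).
nra.
Qed.

Lemma rho_plus_cvg {R : realType} {X : normedModType R} (x y : X) :
  rho_quotient x y t @[t --> 0^'+] --> rho_plus x y.
Proof.
apply/cvg_ex; eexists.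
apply: (@nondecreasing_at_right_cvgr _ (rho_quotient x y) 0 (BInfty R false)) => //.
- move=> s t; rewrite !in_itv/= !andbT => s0 t0; exact: rho_quotient_mono.
- exists (- (`|x| * `|y|)) => _ [t + <-]; rewrite /= in_itv/= andbT.
  exact: rho_quotient_ge.
Qed.

Lemma rho_plus_le_quotient {R : realType} {X : normedModType R} (x y : X) (t : R) :
  0 < t -> rho_plus x y <= rho_quotient x y t.
Proof.
move=> t0; apply: (limr_le _) => /=.
  by apply/cvg_ex; eexists; exact: rho_plus_cvg.
near=> s; apply: rho_quotient_mono; near: s.
- exact: nbhs_right_gt.
- exact: nbhs_right_le.
Unshelve. all: by end_near. Qed.

Lemma le_rho_plus {R : realType} {X : normedModType R} (x y : X) (c : R) :
  (forall t, 0 < t -> c <= rho_quotient x y t) -> c <= rho_plus x y.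
Proof.
move=> cq; apply: limr_ge; first by apply/cvg_ex; eexists; exact: rho_plus_cvg.
by near=> s; apply: cq; near: s; exact: nbhs_right_gt.
Unshelve. all: by end_near. Qed.

(** The tangent line inequality: the difference quotient at [1] dominates the
    derivative. *)
Lemma sqr_norm_ge {R : realType} {X : normedModType R} (x y : X) :
  `|x| ^+ 2 + 2 * rho_plus x y <= `|x + y| ^+ 2.
Proof.
have := rho_plus_le_quotient x y 1 ltr01.
by rewrite /rho_quotient scale1r; lra.
Qed.

Lemma rho_minusE {R : realType} {X : normedModType R} (x y : X) :
  rho_minus x y = - rho_plus x (- y).
Proof.
apply: cvg_lim => //; apply/cvg_at_leftNP; rewrite oppr0.
rewrite [X in X @ _](_ : _ = (fun t => - rho_quotient x (- y) t)).
  by apply: cvgN; exact: rho_plus_cvg.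
apply/funext => t; rewrite /rho_quotient/= scaleNr scalerN.
by rewrite mulrN invrN mulrN.
Qed.

(** The midpoint of [x + 2 r y] and [x + 2 r z] is [x + r (y + z)], so convexity
    bounds the quotient of [y + z] at [r] by the sum of those of [y] and [z] at
    [2 r]. *)
Lemma rho_plus_sublinear {R : realType} {X : normedModType R} (x : X) :
  sublinear (rho_plus x).
Proof.
split=> [y z|a y a0].
- rewrite -lerBlDr; apply: le_rho_plus => s s0; rewrite lerBlDr -lerBlDl.
  apply: le_rho_plus => t t0; rewrite lerBlDl.
  pose r := Order.min s t / 2.
  have m0 : 0 < Order.min s t by rewrite lt_min s0.
  have r0 : 0 < r by rewrite divr_gt0.
  have rs : 2 * r <= s by rewrite mulrC divfK// ge_min lexx.
  have rt : 2 * r <= t by rewrite mulrC divfK// ge_min lexx orbT.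
  have r20 : 0 < 2 * r by rewrite mulr_gt0.
  apply: (@le_trans _ _ (rho_quotient x y (2 * r) + rho_quotient x z (2 * r)));
    last by rewrite lerD// rho_quotient_mono.
  apply: (le_trans (rho_plus_le_quotient x (y + z) r r0)).
  have h0 : (0 : R) <= 1 / 2 by lra.
  have h1 : (1 : R) / 2 <= 1 by lra.
  have h2 : (1 : R) - 1 / 2 = 1 / 2 by lra.
  have h3 : 1 / 2 * (2 * r) = r by lra.
  have := sqr_norm_convex (1 / 2) (x + (2 * r) *: y) (x + (2 * r) *: z) h0 h1.
  rewrite h2 !scalerDr !scalerA h3 addrACA -scalerDl -(scalerDr r).
  rewrite (_ : 1 / 2 + 1 / 2 = 1 :> R); last by lra.
  rewrite scale1r => h.
  rewrite /rho_quotient -mulrDl ler_pdivrMr ?mulr_gt0//.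
  rewrite [leRHS](_ : _ = 1 / 2 * ((`|x + (2 * r) *: y| ^+ 2 - `|x| ^+ 2) +
     (`|x + (2 * r) *: z| ^+ 2 - `|x| ^+ 2))); first by lra.
  by field; rewrite gt_eqF.
- have [->|an0] := eqVneq a 0.
    rewrite scale0r mul0r; apply: (le_trans (rho_plus_le_quotient x 0 1 ltr01)).
    by rewrite /rho_quotient scaler0 addr0 subrr mul0r.
  have ap : 0 < a by rewrite lt_neqAle eq_sym an0.
  rewrite mulrC -ler_pdivrMr//; apply: le_rho_plus => t t0.
  rewrite ler_pdivrMr//.
  apply: (le_trans (rho_plus_le_quotient x (a *: y) (t / a) _)).
    by rewrite divr_gt0.
  rewrite /rho_quotient scalerA divfK//.
  by rewrite le_eqVlt; apply/orP; left; apply/eqP; field; rewrite an0 gt_eqF.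
Qed.

Lemma rho_plus_self {R : realType} {X : normedModType R} (a : R) (x : X) :
  rho_plus x (a *: x) = a * `|x| ^+ 2.
Proof.
apply: cvg_lim => //.
have : (a + t * (a ^+ 2 / 2)) * `|x| ^+ 2 @[t --> (0:R)^'+] -->
   (a + 0 * (a ^+ 2 / 2)) * `|x| ^+ 2.
  apply: cvgMl; apply: cvgD; first exact: cvg_cst.
  by apply: cvgMl; apply: cvg_at_right_filter; exact: cvg_id.
rewrite mul0r addr0; apply: cvg_trans; apply: near_eq_cvg.
near=> t; have t0 : 0 < t by near: t; exact: nbhs_right_gt.
rewrite /rho_quotient scalerA -{2}[x]scale1r -scalerDl normrZ exprMn.
rewrite real_normK ?num_real//.
by field; rewrite gt_eqF.
Unshelve. all: by end_near. Qed.

Lemma rho_plus_le_norm {R : realType} {X : normedModType R} (x y : X) :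
  rho_plus x y <= `|x| * `|y|.
Proof.
have : `|x| * `|y| + t * (`|y| ^+ 2 / 2) @[t --> (0:R)^'+] -->
   `|x| * `|y| + 0 * (`|y| ^+ 2 / 2).
  apply: cvgD; first exact: cvg_cst.
  by apply: cvgMl; apply: cvg_at_right_filter; exact: cvg_id.
rewrite mul0r addr0 => h; apply: (ler_cvg_to (rho_plus_cvg x y) h).
near=> t; have t0 : 0 < t by near: t; exact: nbhs_right_gt.
rewrite /rho_quotient ler_pdivrMr ?mulr_gt0//.
have : `|x + t *: y| ^+ 2 <= (`|x| + t * `|y|) ^+ 2.
  rewrite lerXn2r ?nnegrE ?addr_ge0 ?mulr_ge0 ?(ltW t0)//.
  by rewrite (le_trans (ler_normD _ _))// normrZ gtr0_norm.
lra.
Unshelve. all: by end_near. Qed.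

Lemma rho_plus_shift {R : realType} {X : normedModType R} (a : R) (x y : X) :
  rho_plus x (a *: x + y) = a * `|x| ^+ 2 + rho_plus x y.
Proof.
apply/le_anti; rewrite -{1}rho_plus_self (rho_plus_sublinear x).1/=.
have := (rho_plus_sublinear x).1 (- a *: x) (a *: x + y).
by rewrite rho_plus_self addrA -scalerDl addNr scale0r add0r; lra.
Qed.

Lemma rho_minus_shift {R : realType} {X : normedModType R} (a : R) (x y : X) :
  rho_minus x (a *: x + y) = a * `|x| ^+ 2 + rho_minus x y.
Proof. by rewrite !rho_minusE opprD -scaleNr rho_plus_shift; lra. Qed.

Lemma rho_minus_le_plus {R : realType} {X : normedModType R} (x y : X) :
  rho_minus x y <= rho_plus x y.
Proof. by rewrite rho_minusE; exact: sublinear_geN (rho_plus_sublinear x). Qed.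

Lemma rho_plusZ2 {R : realType} {X : normedModType R} (a : R) (x y : X) :
  rho_plus (a *: x) (a *: y) = a ^+ 2 * rho_plus x y.
Proof.
apply: cvg_lim => //.
rewrite [X in X @ _](_ : _ = fun t => a ^+ 2 * rho_quotient x y t).
  by apply: cvgMr; exact: rho_plus_cvg.
apply/funext => t; rewrite /rho_quotient scalerA (mulrC t a) -scalerA -scalerDr.
by rewrite !normrZ !exprMn !real_normK ?num_real//; ring.
Qed.

(** For a convex function [phi] and [s > 0], both derivatives at [s] lie between
    the slope over [[0, s]] and the slope over [[s, 2 s]]. The former is at least
    the right derivative at [0], and the latter tends to it. *)
Lemma rho_plus_line_cvg {R : realType} {X : normedModType R} (x y : X) :
  rho_plus (x + s *: y) y @[s --> 0^'+] --> rho_plus x y /\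
  rho_minus (x + s *: y) y @[s --> 0^'+] --> rho_plus x y.
Proof.
have lb (s : R) : 0 < s -> rho_plus x y <= rho_minus (x + s *: y) y.
  move=> s0; apply: (le_trans (rho_plus_le_quotient x y s s0)).
  have := sqr_norm_ge (x + s *: y) (s *: (- y)).
  rewrite (sublinearZ _ _ (rho_plus_sublinear _) (ltW s0)) scalerN addrK.
  rewrite rho_minusE /rho_quotient ler_pdivrMr ?mulr_gt0//; lra.
have ub (s : R) : 0 < s ->
    rho_plus (x + s *: y) y <= rho_quotient x (2 *: y) s - rho_quotient x y s.
  move=> s0; apply: (le_trans (rho_plus_le_quotient _ y s s0)).
  rewrite le_eqVlt; apply/orP; left; apply/eqP.
  rewrite /rho_quotient scalerA -addrA -scalerDl (_ : s + s = s * 2); last by ring.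
  by field; rewrite gt_eqF.
have ubcvg : rho_quotient x (2 *: y) s - rho_quotient x y s @[s --> 0^'+]
    --> rho_plus x y.
  rewrite [X in _ --> X](_ : _ = rho_plus x (2 *: y) - rho_plus x y).
    by apply: cvgB; exact: rho_plus_cvg.
  by rewrite (sublinearZ _ _ (rho_plus_sublinear x))//; ring.
split.
- apply: (squeeze_cvgr _ (cvg_cst _) ubcvg); near=> s.
  have s0 : 0 < s by near: s; exact: nbhs_right_gt.
  by rewrite ub// (le_trans (lb s s0))// rho_minus_le_plus.
- apply: (squeeze_cvgr _ (cvg_cst _) ubcvg); near=> s.
  have s0 : 0 < s by near: s; exact: nbhs_right_gt.
  by rewrite lb// (le_trans _ (ub s s0))// rho_minus_le_plus.
Unshelve. all: by end_near. Qed.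

(** * Smoothness and equality of the norm derivatives *)

Lemma norm_derivatives_at0 {R : realType} {X : normedModType R} (y : X) :
  rho_minus 0 y = 0 /\ rho_plus 0 y = 0.
Proof.
have h z : rho_plus (0 : X) z <= 0.
  by rewrite (le_trans (rho_plus_le_norm _ _))// normr0 mul0r.
have := h y; have := h (- y); have := rho_minus_le_plus 0 y.
by rewrite rho_minusE => h1 h2 h3; split; lra.
Qed.

(** [|x + t y|^2 >= 2 |x + t y| - 1 >= 2 f (x + t y) - 1 = 1 + 2 t f y]. *)
Lemma functional_le_rho_plus {R : realType} {X : normedModType R}
    (f : {linear X -> R^o}) (x y : X) :
  `|x| = 1 -> f x = 1 -> (forall z, f z <= `|z|) -> f y <= rho_plus x y.
Proof.
move=> x1 fx fle; apply: le_rho_plus => t t0.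
rewrite /rho_quotient ler_pdivlMr ?mulr_gt0// x1.
have := fle (x + t *: y); rewrite linearD linearZ/= fx /GRing.scale/=.
by have := sqr_ge0 (`|x + t *: y| - 1); nra.
Qed.

(** The level set [[f = 1]] determines [f] through scaling where [f] is nonzero
    and through translation by [x] on the kernel. It turns uniqueness of the
    hyperplane into uniqueness of the functional. *)
Lemma eq_level_set1 {R : realType} {V : lmodType R} (f g : {linear V -> R^o})
    (x : V) :
  f x = 1 -> g x = 1 -> [set y | f y = 1] = [set y | g y = 1] -> f =1 g.
Proof.
move=> fx gx fg y.
have fg1 z : f z = 1 -> g z = 1 by move: (congr1 (@^~ z) fg) => /= ->.
have [fy0|fy0] := eqVneq (f y) 0.
  have : g (x + y) = 1 by apply: fg1; rewrite linearD fx fy0 addr0.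
  by rewrite linearD/= gx fy0 => /(canRL (addKr _)); rewrite addNr => ->.
have : g ((f y)^-1 *: y) = 1.
  by apply: fg1; rewrite linearZ/= /GRing.scale/= mulVf.
rewrite linearZ/= /GRing.scale/= => h.
by rewrite -[LHS]mulr1 -h mulrA mulfV// mul1r.
Qed.

(** At a unit vector the constant [c] of a supporting hyperplane is the norm of
    [f], hence positive, and one can divide by it. *)
Lemma supporting_hyperplane_unit {R : realType} {X : normedModType R}
    (x : X) (H : set X) : `|x| = 1 ->
  supporting_hyperplane x H <->
  exists f : {linear X -> R^o},
    [/\ f x = 1, forall y, f y <= `|y| & H = [set y | f y = 1]].
Proof.
move=> x1; split.
- move=> [f [c [_ [z fz] -> /= fx fle]]].
  have fnorm y : f y <= c * `|y|.
    have [->|y0] := eqVneq y 0; first by rewrite linear0 normr0 mulr0.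
    have ny : 0 < `|y| by rewrite normr_gt0.
    have := fle (`|y|^-1 *: y); rewrite normrZ normfV normr_id mulVf ?gt_eqF//.
    by rewrite linearZ/= /GRing.scale/= mulrC ler_pdivrMr//; exact.
  have c0 : 0 < c.
    have := fnorm z; have := fnorm (- z); rewrite linearN normrN/= => h1 h2.
    have z0 : 0 < `|z|.
      by rewrite normr_gt0; apply: contra_neq fz => ->; rewrite linear0.
    by rewrite -(pmulr_lgt0 _ z0); move: fz; rewrite neq_lt => /orP[]; lra.
  exists (c^-1 \*: f : {linear X -> R^o}); split => /=.
  + by rewrite /GRing.scale/= fx mulVf ?gt_eqF.
  + by move=> y; rewrite /GRing.scale/= ler_pdivrMl.
  + apply/seteqP; split=> y /=; rewrite /GRing.scale/=.
      by move=> ->; rewrite mulVf ?gt_eqF.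
    by move=> /(canRL (mulVKf _)) ->; rewrite ?mulr1// gt_eqF.
- move=> [f [fx fle ->]]; exists f, 1; split => //.
  + move=> y; apply/cvgrPdist_lt => e e0; near=> z.
    rewrite -linearB; apply: (@le_lt_trans _ _ `|y - z|).
      rewrite ler_norml fle andbT lerNl -linearN.
      by rewrite -normrN fle.
    by near: z; apply: cvgr_dist_lt.
  + by exists x; rewrite fx oner_neq0.
  + by move=> y y1; exact: le_trans (fle y) y1.
Unshelve. all: by end_near. Qed.

(** If [rho_plus x] is not odd, Hahn-Banach yields two distinct functionals
    below it, one touching it at [y] and the other at [- y]; both are
    supporting. If it is odd, it is linear and is the only supporting functional. *)
Lemma smoothP {R : realType} (X : normedModType R) :
  smooth X <-> forall x y : X, rho_minus x y = rho_plus x y.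
Proof.
split=> [Xs x y|rhoE x x1].
- have [->|x0] := eqVneq x 0.
    by have [-> ->] := norm_derivatives_at0 y.
  have nx : `|x| != 0 by rewrite normr_eq0.
  pose u := `|x|^-1 *: x.
  have u1 : `|u| = 1 by rewrite normrZ normfV normr_id mulVf.
  have supp (f : {linear X -> R^o}) : (forall z, f z <= rho_plus u z) ->
      f u = 1 /\ supporting_hyperplane u [set z | f z = 1].
    move=> fle.
    have fu : f u = 1.
      apply/le_anti; apply/andP; split.
        by have := fle (1 *: u); rewrite rho_plus_self scale1r u1 expr1n mulr1.
      have := fle (- 1 *: u); rewrite rho_plus_self u1 expr1n mulr1.
      by rewrite scaleN1r linearN lerN2.
    split=> //; apply/supporting_hyperplane_unit => //; exists f; split=> // z.
    by rewrite (le_trans (fle z))// (le_trans (rho_plus_le_norm _ _))// u1 mul1r.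
  have rhou v : rho_minus u v = rho_plus u v.
    have [f [fle fv]] := hahn_banach v (rho_plus_sublinear u).
    have [g [gle gv]] := hahn_banach (- v) (rho_plus_sublinear u).
    have [fu fs] := supp f fle; have [gu gs] := supp g gle.
    have [H [_ Huniq]] := Xs u u1.
    have fg := eq_level_set1 f g u fu gu (etrans (esym (Huniq _ fs)) (Huniq _ gs)).
    by rewrite rho_minusE -gv -fv fg linearN opprK.
  have -> : x = `|x| *: u by rewrite /u scalerA mulfV// scale1r.
  have -> : y = `|x| *: (`|x|^-1 *: y) by rewrite scalerA mulfV// scale1r.
  by rewrite rho_minusE -scalerN 2!(rho_plusZ2 _ u) -mulrN -rho_minusE rhou.
- have podd y : rho_plus x (- y) <= - rho_plus x y.
    by rewrite -rhoE rho_minusE opprK.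
  have [f fE] := odd_sublinear_linear (rho_plus_sublinear x) podd.
  have fx : f x = 1.
    by rewrite fE -[X in rho_plus _ X]scale1r rho_plus_self x1 expr1n mulr1.
  exists [set y | f y = 1]; split.
    apply/supporting_hyperplane_unit => //; exists f; split=> // y.
    by rewrite fE (le_trans (rho_plus_le_norm _ _))// x1 mul1r.
  move=> H /(supporting_hyperplane_unit _ _ x1)[g [gx gle ->]].
  have gE y : g y = f y.
    apply/le_anti; rewrite fE functional_le_rho_plus//=.
    have := functional_le_rho_plus g x (- y) x1 gx gle.
    by rewrite linearN/= => h; have := podd y; lra.
  by apply/seteqP; split=> y /=; rewrite gE.
Qed.

(** * Linear maps preserving orthogonality *)

(** At every point of the line the left derivative of [s |-> |x + s z|^2] is
    nonpositive and the right one nonnegative. By the tangent line inequality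
    this function is both nondecreasing and nonincreasing, but it is unbounded
    unless [z = 0]. *)
Lemma eq0_rho_line {R : realType} {X : normedModType R} (x z : X) :
  (forall s : R, rho (x + s *: z) z = 0) -> z = 0.
Proof.
move=> rho0.
have step (s t : R) : 0 < t ->
    `|x + s *: z| <= `|x + (s + t) *: z| /\ `|x + s *: z| <= `|x + (s - t) *: z|.
  move=> t0.
  have := rho0 s; have := rho_minus_le_plus (x + s *: z) z.
  have := sqr_norm_ge (x + s *: z) (t *: z).
  have := sqr_norm_ge (x + s *: z) (t *: (- z)).
  rewrite !(sublinearZ _ _ (rho_plus_sublinear _) (ltW t0)).
  rewrite scalerN -scaleNr -!addrA -!scalerDl /rho rho_minusE.
  move=> h1 h2 h3 h4.
  by split; rewrite -(ler_pXn2r (ltn0Sn 1)) ?nnegrE//; nra.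
apply/eqP; apply: contraT => z0.
have nz : 0 < `|z| by rewrite normr_gt0.
pose s := (2 * `|x| + 1) / `|z|.
have s0 : 0 < s by rewrite divr_gt0// ltr_wpDl// mulr_ge0.
have [_] := step s s s0; rewrite subrr scale0r addr0 => h.
have : `|s *: z| <= `|x + s *: z| + `|x|.
  by rewrite -[X in `|X| <= _](addKr x) addrC (le_trans (ler_normB _ _)).
rewrite normrZ gtr0_norm// divfK ?gt_eqF//; lra.
Qed.

(** [T] is constant on the line through [x] in a direction [z] of its kernel, so
    [T] does not vanish on that line as soon as [T x] is nonzero. *)
Lemma linear_inj_of_rho {R : realType} {X Y : normedModType R}
    (T : {linear X -> Y}) :
  nonvanishing T ->
  (forall x z, T z = 0 -> rho x z * `|T x| ^+ 2 = 0) ->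
  forall z, T z = 0 -> z = 0.
Proof.
move=> [x Tx] Trho z Tz; apply: (eq0_rho_line x) => s.
have := Trho (x + s *: z) z Tz; rewrite linearD linearZ/= Tz scaler0 addr0.
by move=> /eqP; rewrite mulf_eq0 sqrf_eq0 normr_eq0 (negPf Tx) orbF => /eqP.
Qed.

Lemma rho_shift {R : realType} {X : normedModType R} (a : R) (x y : X) :
  rho x (a *: x + y) = a * `|x| ^+ 2 + rho x y.
Proof. by rewrite /rho rho_plus_shift rho_minus_shift; lra. Qed.

Lemma rho0r {R : realType} {X : normedModType R} (x : X) : rho x 0 = 0.
Proof.
rewrite /rho rho_minusE oppr0 (sublinear0 (rho_plus_sublinear x)).
by rewrite oppr0 addr0 mulr0.
Qed.

(** A root [c] of [(c - rho_minus x y) (c - rho_plus x y)] makes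
    [y - (c / |x|^2) x] orthogonal to [x] for [rho_star]. *)
Lemma rho_star_to_rho {R : realType} {X Y : normedModType R}
    (T : {linear X -> Y}) :
  (forall x y, rho_star_orthogonal x y -> rho_orthogonal (T x) (T y)) ->
  forall x y, rho_plus x y * `|T x| ^+ 2 = rho (T x) (T y) * `|x| ^+ 2 /\
    rho_minus x y * `|T x| ^+ 2 = rho (T x) (T y) * `|x| ^+ 2.
Proof.
move=> Tpres x y.
have [->|x0] := eqVneq x 0.
  have [-> ->] := norm_derivatives_at0 y.
  by rewrite linear0 !normr0 expr0n/= !mulr0.
have nx : `|x| ^+ 2 != 0 by rewrite sqrf_eq0 normr_eq0.
have key (c : R) :
    (c - rho_minus x y) * (c - rho_plus x y) = 0 ->
    c * `|T x| ^+ 2 = rho (T x) (T y) * `|x| ^+ 2.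
  move=> hc; have := Tpres x (- (c / `|x| ^+ 2) *: x + y).
  rewrite /rho_star_orthogonal /rho_star rho_plus_shift rho_minus_shift.
  rewrite mulNr divfK// => /(_ _)h.
  have : rho (T x) (T (- (c / `|x| ^+ 2) *: x + y)) = 0.
    by apply: h; rewrite -[RHS]hc; ring.
  rewrite linearD linearZ/= rho_shift => h'.
  have -> : rho (T x) (T y) = c / `|x| ^+ 2 * `|T x| ^+ 2 by lra.
  by rewrite mulrAC divfK.
by split; apply: key; rewrite subrr ?mulr0 ?mul0r.
Qed.

(** The vector [y - (rho x y / |x|^2) x] is orthogonal to [x] for [rho]. *)
Lemma rho_to_rho_star {R : realType} {X Y : normedModType R}
    (T : {linear X -> Y}) :
  (forall x y, rho_orthogonal x y -> rho_star_orthogonal (T x) (T y)) ->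
  forall x y,
    (rho x y * `|T x| ^+ 2 - rho_minus (T x) (T y) * `|x| ^+ 2) *
    (rho x y * `|T x| ^+ 2 - rho_plus (T x) (T y) * `|x| ^+ 2) = 0.
Proof.
move=> Tpres x y.
have [->|x0] := eqVneq x 0.
  by rewrite linear0 !normr0 expr0n/= !mulr0 subrr mul0r.
have nx : `|x| ^+ 2 != 0 by rewrite sqrf_eq0 normr_eq0.
pose c := - (rho x y / `|x| ^+ 2).
have : rho_star (T x) (T (c *: x + y)) = 0.
  by apply: Tpres; rewrite /rho_orthogonal rho_shift mulNr divfK// addNr.
rewrite linearD linearZ/= /rho_star rho_plus_shift rho_minus_shift => h.
have -> : rho x y = - c * `|x| ^+ 2 by rewrite opprK divfK.
rewrite [LHS](_ : _ = `|x| ^+ 2 * `|x| ^+ 2 *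
  ((c * `|T x| ^+ 2 + rho_minus (T x) (T y)) *
   (c * `|T x| ^+ 2 + rho_plus (T x) (T y)))); last by ring.
by rewrite h mulr0.
Qed.

Lemma sqr_norm_line_cvg {R : realType} {X : normedModType R} (x y : X) :
  `|x + s *: y| ^+ 2 @[s --> (0 : R)^'+] --> `|x| ^+ 2.
Proof.
apply: cvg_at_right_filter.
have : x + s *: y @[s --> (0 : R)] --> x + 0 *: y.
  by apply: cvgD; [exact: cvg_cst|apply: cvgZr_tmp; exact: cvg_id].
rewrite scale0r addr0 => /cvg_norm h.
by rewrite expr2; under eq_fun do rewrite expr2; exact: cvgM.
Qed.

(** As [s] decreases to [0], both factors of the identity [rho_to_rho_star] at
    [x + s y] tend to the same difference, whose square is therefore zero. *)
Lemma rho_plus_similar {R : realType} {X Y : normedModType R}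
    (T : {linear X -> Y}) :
  (forall x y, rho_orthogonal x y -> rho_star_orthogonal (T x) (T y)) ->
  forall x y, rho_plus x y * `|T x| ^+ 2 = rho_plus (T x) (T y) * `|x| ^+ 2.
Proof.
move=> Tpres x y.
have [Xp Xm] := rho_plus_line_cvg x y.
have [Yp Ym] := rho_plus_line_cvg (T x) (T y).
have nX := sqr_norm_line_cvg x y; have nY := sqr_norm_line_cvg (T x) (T y).
have Xr : rho (x + s *: y) y @[s --> (0 : R)^'+] --> rho_plus x y.
  rewrite [X in _ --> X](_ : _ = 2^-1 * (rho_plus x y + rho_plus x y)); last by lra.
  by apply: cvgMr; exact: cvgD.
have lim : (rho (x + s *: y) y * `|T x + s *: T y| ^+ 2
      - rho_minus (T x + s *: T y) (T y) * `|x + s *: y| ^+ 2)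
    * (rho (x + s *: y) y * `|T x + s *: T y| ^+ 2
      - rho_plus (T x + s *: T y) (T y) * `|x + s *: y| ^+ 2) @[s --> (0 : R)^'+]
    --> (rho_plus x y * `|T x| ^+ 2 - rho_plus (T x) (T y) * `|x| ^+ 2) ^+ 2.
  by rewrite [X in _ --> X]expr2; apply: cvgM; apply: cvgB; exact: cvgM.
apply/eqP; rewrite -subr_eq0 -sqrf_eq0; apply/eqP.
apply: (cvg_unique (@Rhausdorff R) lim).
rewrite [X in X @ _](_ : _ = cst 0); first exact: cvg_cst.
apply/funext => s /=; have := rho_to_rho_star T Tpres (x + s *: y) y.
by rewrite linearD linearZ.
Qed.

Theorem theorem3p3 (R : realType) (X : normedModType R) (hX : dim_ge2 X) :
  (smooth X <->
   exists (Y : normedModType R) (T : {linear X -> Y}),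
     nonvanishing T /\
     forall x y : X, rho_star_orthogonal x y -> rho_orthogonal (T x) (T y)) /\
  (smooth X <->
   exists (Y : normedModType R) (T : {linear X -> Y}),
     nonvanishing T /\
     forall x y : X, rho_orthogonal x y -> rho_star_orthogonal (T x) (T y)).
Proof.
have idX : @nonvanishing R X X (@idfun X : {linear X -> X}).
  have [x [y xy]] := hX; exists x; apply/eqP => /= x0.
  have [] := xy 1 0; first by rewrite x0 scaler0 scale0r addr0.
  by move=> /eqP; rewrite oner_eq0.
split; split.
- move=> /smoothP rhoE; exists X, (@idfun X : {linear X -> X}); split=> // x y.
  rewrite /rho_star_orthogonal /rho_orthogonal /rho_star /rho/= !rhoE.
  by move=> /eqP; rewrite mulf_eq0 orbb => /eqP ->; rewrite addr0 mulr0.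
- move=> [Y [T [T0 Tpres]]]; apply/smoothP => x y.
  have Tsim := rho_star_to_rho T Tpres.
  have Tinj : forall z, T z = 0 -> z = 0.
    apply: linear_inj_of_rho => // u z Tz.
    have [hp hm] := Tsim u z; move: hp hm; rewrite Tz rho0r mul0r /rho => hp hm.
    by rewrite -mulrA mulrDl hp hm addr0 mulr0.
  have [->|x0] := eqVneq x 0; first by have [-> ->] := norm_derivatives_at0 y.
  have nTx : `|T x| ^+ 2 != 0.
    by rewrite sqrf_eq0 normr_eq0; apply: contra_neq x0 => /Tinj.
  by apply: (mulIf nTx); rewrite (Tsim x y).1 (Tsim x y).2.
- move=> /smoothP rhoE; exists X, (@idfun X : {linear X -> X}); split=> // x y.
  rewrite /rho_star_orthogonal /rho_orthogonal /rho_star /rho/= !rhoE.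
  move=> h; have -> : rho_plus x y = 0 by lra.
  by rewrite mulr0.
- move=> [Y [T [T0 Tpres]]]; apply/smoothP => x y.
  have Tstar := rho_to_rho_star T Tpres.
  have Tplus := rho_plus_similar T Tpres.
  have Tinj : forall z, T z = 0 -> z = 0.
    apply: linear_inj_of_rho => // u z Tz.
    have := Tstar u z; rewrite Tz rho_minusE oppr0.
    rewrite (sublinear0 (rho_plus_sublinear _)) oppr0 mul0r subr0 => /eqP.
    by rewrite mulf_eq0 orbb => /eqP.
  have [->|x0] := eqVneq x 0; first by have [-> ->] := norm_derivatives_at0 y.
  have nTx : `|T x| ^+ 2 != 0.
    by rewrite sqrf_eq0 normr_eq0; apply: contra_neq x0 => /Tinj.
  have Tminus : rho_minus x y * `|T x| ^+ 2 = rho_minus (T x) (T y) * `|x| ^+ 2.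
    by rewrite !rho_minusE !mulNr Tplus linearN.
  (* [rho x y] is the mean of [rho_minus x y] and [rho_plus x y], and one of them. *)
  have := Tstar x y; rewrite -Tplus -Tminus -!mulrBl mulrACA => /eqP.
  rewrite mulf_eq0 (mulf_eq0 (_ ^+ 2)) (negPf nTx) !orbF mulf_eq0.
  by rewrite /rho => /orP[] /eqP; lra.
Qed.
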